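(* Let $d\ge 3$, let $A\subseteq \mathbb{D}\setminus\{1\}$ satisfy $\{\bar c\mid c\in A\}=A$, and put $$D=\left\{(u,v,t)\in A^3 \;\middle|\; \begin{pmatrix}1&u&v\\ \bar u&1&t\\ \bar v&\bar t&1\end{pmatrix}\succeq 0\right\},$$ $$D_0=\{(u,u,1)\mid u\in A\}\cup\{(u,1,\bar u)\mid u\in A\}\cup\{(1,u,u)\mid u\in A\}.$$ Let $X$ be a nonempty finite subset of $\Omega(d)$ with $A(X)\subseteq A$. Then $$|X|\le 1+\sup \sum_{u\in A}x(u,u,1),$$ where the supremum is over all real-valued functions $x$ on $A^3\cup D_0$ satisfying all of the following constraints: 1. $x(u,v,t)=x(v,u,\bar t)=x(\bar t,\bar v,\bar u)=x(\bar v,\bar t,u)=x(\bar u,t,v)=x(t,\bar u,\bar v)$ for all $u,v,t\in A$; 2. $x(u,v,t)\ge 0$ for all $(u,v,t)\in D$; 3. $x(u,v,t)=0$ for all but finitely many $(u,v,t)\in D\cup D_0$; 4. $\begin{pmatrix}1&0\\0&0\end{pmatrix}+\sum_{u\in A}x(u,u,1)\begin{pmatrix}0&1\\1&1\end{pmatrix}+\sum_{(u,v,t)\in D}x(u,v,t)\begin{pmatrix}0&0\\0&1\end{pmatrix}\succeq 0$; 5. $g^d_{k,l}(1)+\sum_{u\in A}x(u,u,1)\,g^d_{k,l}(u)\ge 0$ (in particular, this number is real) for all integers $k,l\ge 0$; 6. $Y^{i,j}_{k,l}(1,1,1)+\sum_{(u,v,t)\in D\cup D_0}x(u,v,t)\,Y^{i,j}_{k,l}(u,v,t)\succeq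 0$ for all integers $k,l\ge 0$ and all $0\le i\le k$, $0\le j\le l$.
   Context: $\Omega(d)=\{x\in\mathbb{C}^d\mid x^*x=1\}$ is the complex unit sphere, where $x^*$ is the conjugate transpose. $\mathbb{D}=\{z\in\mathbb{C}\mid |z|\le 1\}$. For $X\subseteq\Omega(d)$, $A(X)=\{a^*b\mid a,b\in X,\ a\ne b\}$. $M\succeq 0$ means that the complex matrix $M$ is Hermitian positive semidefinite. For an integer $n\ge 2$ and integers $k,l\ge 0$, the Jacobi polynomial is $$g^n_{k,l}(x)=\frac{m^n_{k,l}(n-2)!\,k!\,l!}{(n+k-2)!(n+l-2)!}\sum_{r=0}^{\min\{k,l\}}(-1)^r\frac{(n+k+l-r-2)!}{r!(k-r)!(l-r)!}x^{k-r}\bar x^{\,l-r},$$ where $$m^n_{k,l}=\binom{n+k-1}{n-1}\binom{n+l-1}{n-1}-\binom{n+k-2}{n-1}\binom{n+l-2}{n-1}.$$ For $k,l\ge0$, $0\le i\le k$, $0\le j\le l$, set $m^{i,j}_{k,l}=\min(k-i,l-j)+1$. $Y^{i,j}_{k,l}(u,v,t)$ is the matrix with rows and columns indexed by $0\le a,b\le m^{i,j}_{k,l}$ and entries $$(Y^{i,j}_{k,l}(u,v,t))_{a,b}=(1-u\bar u)^{(i+j)/2}(1-v\bar v)^{(i+j)/2}(u\bar u)^a(v\bar v)^b\, g^{d-1}_{i,j}\!\left(\frac{t-\bar u v}{\sqrt{(1-u\bar u)(1-v\bar v)}}\right).$$ After cancellation the right-hand side is a polynomial in $u,\bar u,v,\bar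 v,t,\bar t$ (the $r$-th term of $g^{d-1}_{i,j}$ contributes a multiple of $((1-u\bar u)(1-v\bar v))^{r}(t-\bar uv)^{i-r}\overline{(t-\bar uv)}^{\,j-r}$), and this polynomial is used when $|u|=1$ or $|v|=1$. The convention $z^0=1$ is used for every $z$, including $z=0$. *)

(* Defs.v *)
From HB Require Import structures.
From mathcomp Require Import all_boot all_order all_algebra.
From mathcomp Require Import finmap complex ring.
From mathcomp Require Import boolp classical_sets functions cardinality fsbigop.
From mathcomp Require Import reals constructive_ereal ereal.

Set Implicit Arguments.
Unset Strict Implicit.
Unset Printing Implicit Defensive.
Import Order.TTheory GRing.Theory Num.Theory.
Local Open Scope classical_set_scope.
Local Open Scope complex_scope.
Local Open Scope sesquilinear_scope.
Local Open Scope ring_scope.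

Section NumClosed.
Variable C : numClosedFieldType.

(* In a numClosedFieldType, [0 <= z] means that z is real and nonnegative. *)
Definition psdmx (n : nat) (M : 'M[C]_n) : Prop :=
  M \is hermsymmx /\ forall w : 'cV[C]_n, 0 <= (w ^t* *m M *m w) 0 0.

Definition mx2 (a b c d : C) : 'M[C]_2 :=
  \matrix_(i < 2, j < 2) nth 0 (nth [::] [:: [:: a; b]; [:: c; d]] i) j.

Definition gram3 (u v t : C) : 'M[C]_3 :=
  \matrix_(i < 3, j < 3)
    nth 0 (nth [::] [:: [:: 1;    u;    v];
                        [:: u^*;  1;    t];
                        [:: v^*;  t^*;  1]] i) j.

Definition jacobi_m (n k l : nat) : C :=
  ('C(n + k - 1, n - 1) * 'C(n + l - 1, n - 1))%N%:R
  - ('C(n + k - 2, n - 1) * 'C(n + l - 2, n - 1))%N%:R.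

(* The truncated subtractions below are exact for 2 <= n and r <= minn k l. *)
Definition jacobi_scale (n k l : nat) : C :=
  jacobi_m n k l * ((n - 2)`! * k`! * l`!)%N%:R
  / ((n + k - 2)`! * (n + l - 2)`!)%N%:R.

Definition jacobi_coef (n k l r : nat) : C :=
  (- 1) ^+ r * ((n + k + l - r - 2)`!)%:R
  / (r`! * (k - r)`! * (l - r)`!)%N%:R.

Definition jacobi (n k l : nat) (z : C) : C :=
  jacobi_scale n k l *
  \sum_(r < (minn k l).+1) jacobi_coef n k l r * z ^+ (k - r) * z^* ^+ (l - r).

(* For s > 0 this is s ^ ((k + l) / 2) * jacobi n k l (z / sqrt s), written as
   a polynomial in s, z and the conjugate of z; see [jacobi_homE]. *)
Definition jacobi_hom (n k l : nat) (s z : C) : C :=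
  jacobi_scale n k l *
  \sum_(r < (minn k l).+1)
    jacobi_coef n k l r * s ^+ r * z ^+ (k - r) * z^* ^+ (l - r).

(* The half-integer power z ^ ((i + j) / 2) is written sqrtC z ^+ (i + j). *)
Definition Yentry (d i j : nat) (u v t : C) (a b : nat) : C :=
  if (`|u| == 1) || (`|v| == 1) then
    (u * u^*) ^+ a * (v * v^*) ^+ b *
    jacobi_hom (d - 1) i j ((1 - u * u^*) * (1 - v * v^*)) (t - u^* * v)
  else
    sqrtC (1 - u * u^*) ^+ (i + j) * sqrtC (1 - v * v^*) ^+ (i + j) *
    (u * u^*) ^+ a * (v * v^*) ^+ b *
    jacobi (d - 1) i j
      ((t - u^* * v) / sqrtC ((1 - u * u^*) * (1 - v * v^*))).

Definition Ym (k l i j : nat) : nat := (minn (k - i) (l - j) + 1)%N.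

(* Indices run over 0 <= a, b <= Ym k l i j, both ends included. *)
Definition Ymx (d k l i j : nat) (u v t : C) : 'M[C]_((Ym k l i j).+1) :=
  \matrix_(a < (Ym k l i j).+1, b < (Ym k l i j).+1) Yentry d i j u v t a b.

Definition sphere (d : nat) : set 'cV[C]_d :=
  [set x | (x ^t* *m x) 0 0 = 1].

Definition angles (d : nat) (X : set 'cV[C]_d) : set C :=
  [set z | exists a b, [/\ X a, X b, a <> b & z = (a ^t* *m b) 0 0]].

Definition tripleD (A : set C) : set (C * C * C) :=
  [set p | [/\ A p.1.1, A p.1.2, A p.2 & psdmx (gram3 p.1.1 p.1.2 p.2)]].

Definition tripleD0 (A : set C) : set (C * C * C) :=
  [set (u, u, 1) | u in A] `|` [set (u, 1, u^*) | u in A]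
  `|` [set (1, u, u) | u in A].

Lemma jacobi_homE (n k l : nat) (s z : C) : 0 < s ->
  jacobi_hom n k l s z = sqrtC s ^+ (k + l) * jacobi n k l (z / sqrtC s).
Proof.
move=> s0; rewrite /jacobi_hom /jacobi mulrCA; congr (_ * _).
rewrite mulr_sumr; apply: eq_bigr => -[r /=]; rewrite ltnS leq_min.
case/andP=> rk rl _.
have q0 : sqrtC s != 0 by rewrite sqrtC_eq0 gt_eqF.
have qc : (sqrtC s)^* = sqrtC s by apply: conj_Creal; rewrite sqrtC_real ?ltW.
have -> : (z / sqrtC s)^* = z^* / sqrtC s.
  by rewrite rmorphM /= fmorphV; congr (_ / _); exact: qc.
rewrite !expr_div_n -{1}(sqrtCK s) -exprM mul2n.
have -> : (k + l = r.*2 + (k - r) + (l - r))%N.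
  by rewrite -addnn -addnA addnACA !subnKC.
rewrite !exprD; field.
by rewrite !expf_neq0.
Qed.

Lemma YentryE (d i j : nat) (u v t : C) (a b : nat) : `|u| < 1 -> `|v| < 1 ->
  Yentry d i j u v t a b =
  (u * u^*) ^+ a * (v * v^*) ^+ b *
  jacobi_hom (d - 1) i j ((1 - u * u^*) * (1 - v * v^*)) (t - u^* * v).
Proof.
move=> u1 v1; rewrite /Yentry !lt_eqF //=.
have pos w : `|w : C| < 1 -> 0 < 1 - w * w^*.
  by move=> w1; rewrite -normCK subr_gt0 expr_lt1.
have pu := pos _ u1; have pv := pos _ v1.
rewrite jacobi_homE ?mulr_gt0 // -exprMn -sqrtCM ?nnegrE ?ltW //.
by rewrite -!mulrA mulrCA; congr (_ * _); rewrite mulrCA.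
Qed.

End NumClosed.

Arguments sphere {C} d _.

(* An element is a total function on triples, of which the constraints only
   read the values on A^3 and on [tripleD0 A]. Each sum over a possibly
   infinite set has finite support by [finite_set], so it is a genuine finite
   sum and not the default value 0. *)
Definition feasible (R : realType) (d : nat) (A : set R[i]) :
    set (R[i] * R[i] * R[i] -> R) :=
  [set x |
    [/\ forall u v t, A u -> A v -> A t ->
          [/\ x (u, v, t) = x (v, u, t^*),
              x (u, v, t) = x (t^*, v^*, u^*),
              x (u, v, t) = x (v^*, t^*, u),
              x (u, v, t) = x (u^*, t, v) &
              x (u, v, t) = x (t, u^*, v^*)],
        forall u v t, tripleD A (u, v, t) -> 0 <= x (u, v, t),
        finite_set [set p | (tripleD A `|` tripleD0 A) p /\ x p <> 0] &
    [/\ psdmx (mx2 1 0 0 0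
               + \sum_(u \in A) (x (u, u, 1))%:C *: mx2 0 1 1 1
               + \sum_(p \in tripleD A) (x p)%:C *: mx2 0 0 0 1),
        forall k l : nat,
          0 <= jacobi d k l 1
               + \sum_(u \in A) (x (u, u, 1))%:C * jacobi d k l u &
        forall k l i j : nat, (i <= k)%N -> (j <= l)%N ->
          psdmx (Ymx d k l i j 1 1 1
                 + \sum_(p \in tripleD A `|` tripleD0 A)
                     (x p)%:C *: Ymx d k l i j p.1.1 p.1.2 p.2)]]].

(* Main.v *)
From HB Require Import structures.
Require Import Defs.
From mathcomp Require Import all_boot all_order all_algebra.
From mathcomp Require Import ring zify.
From mathcomp Require mpoly.

(** A code X of N points yields a feasible point of the program with objective
    N - 1: let x(u, v, t) be 1/N times the number of triples (a, b, c) in X^3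
    with a^* b = u, a^* c = v and b^* c = t ([triangle_density]). Each sum over
    inner products then becomes a sum over pairs or triples of points
    ([fsbig_fiber]). Since A omits 1, two points coincide exactly when their
    inner product falls outside A; so triples of distinct points are those that
    land in D, and triples with exactly two equal points those that land in D_0
    ([triangle_in_D], [triangle_in_DD0]). The remaining triples (a, a, a)
    account for the constant terms of the constraints ([sum_pairs],
    [sum_triples]).

    After this translation the 2 by 2 constraint is an explicit matrix of rank
    one. The other two say that kernels are positive. The one on g^d_{k,l} is
    the positivity on X of the kernel g^d_{k,l}(a^* b). For the matrices Y, fix
    the first point a and project the others to the orthogonal complement of a,
    a space of dimension d - 1: each entry of Y becomes a power of |u|^2 and
    |v|^2 times the homogenized Jacobi kernel of dimension d - 1 at the
    projections ([Ymx_sum_psd]), and the half-integer powers disappear.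

    Both cases follow from one fact ([Fischer.jacobi_hom_psd]): for n >= 2 the
    kernel |x|^(k+l) |y|^(k+l) g^n_{k,l}(x^* y / (|x| |y|)) on C^n is positive
    semidefinite. To see it, give the polynomials in z and its conjugate the
    Fischer form, for which multiplication by a variable is adjoint to the
    derivative in that variable. The polynomial
      F_x = sum_r c_r |x|^2r |z|^2r (x^T z)^(k-r) (x^* zbar)^(l-r),
    where c_r are the coefficients of the Jacobi polynomial, is killed by the
    Laplacian ([Fischer.lap_zonal]), the adjoint of multiplication by |z|^2.
    Hence in <F_x, F_y> only the leading term of F_y survives, and moving all
    factors across by adjointness evaluates <F_x, F_y> to a positive multiple of
    the Jacobi kernel ([Fischer.fischer_zonal]). The kernel is a Gram
    matrix. *)

Set Implicit Arguments.
Unset Strict Implicit.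
Unset Printing Implicit Defensive.
Import Order.TTheory GRing.Theory Num.Theory.
Local Open Scope ring_scope.

(** * The inner product *)

Section Dot.
Variables (C : numClosedFieldType) (n : nat).
Local Open Scope sesquilinear_scope.
Implicit Types x y : 'cV[C]_n.

Definition dot x y : C := (x ^t* *m y) 0 0.

Lemma dotE x y : dot x y = \sum_i (x i 0)^* * y i 0.
Proof. by rewrite /dot mxE; apply: eq_bigr => i _; rewrite !mxE. Qed.

Lemma dotC x y : dot y x = (dot x y)^*.
Proof.
rewrite !dotE rmorph_sum; apply: eq_bigr => i _.
by rewrite rmorphM /= conjCK mulrC.
Qed.

End Dot.

(** * The Fischer form on polynomials *)

Module Fischer.
Import mpoly.

Section Form.
Variables (C : numClosedFieldType) (n : nat).
Implicit Types (p q : {mpoly C[n]}) (m : 'X_{1..n}).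

(** The weight for which multiplication by a variable and differentiation in
    that variable become adjoint. *)
Definition mfact m : C := (\prod_i (m i)`!)%:R.

Definition fischer p q : C :=
  \sum_(m <- msupp p) mfact m * ((p@_m)^* * q@_m).

Lemma mfact_ge0 m : 0 <= mfact m.
Proof. exact: ler0n. Qed.

Lemma mfactU m i : mfact (U_(i) + m)%MM = (m i).+1%:R * mfact m.
Proof.
rewrite /mfact -natrM (bigD1 i) //= [in RHS](bigD1 i) //= mnmDE mnm1E eqxx.
rewrite factS mulnA; congr ((_ * _)%N%:R); apply: eq_bigr => j ji.
by rewrite mnmDE mnm1E eq_sym (negbTE ji).
Qed.

(** The support of the first argument varies with that argument; summing over
    any larger index list makes the form comparable between polynomials. *)
Lemma fischerE (e : seq 'X_{1..n}) p q : uniq e -> {subset msupp p <= e} ->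
  fischer p q = \sum_(m <- e) mfact m * ((p@_m)^* * q@_m).
Proof.
move=> us ps; rewrite /fischer [RHS](bigID (mem (msupp p))) /=.
rewrite [X in _ = _ + X]big1 ?addr0 => [|m]; last first.
  by move=> /memN_msupp_eq0 ->; rewrite conjC0 mul0r mulr0.
rewrite -[RHS]big_filter; apply: perm_big; apply: uniq_perm => //.
  exact: filter_uniq.
by move=> m; rewrite mem_filter; case: (boolP (m \in msupp p)) => //= /ps ->.
Qed.

Lemma fischerC p q : fischer q p = (fischer p q)^*.
Proof.
pose e := undup (msupp p ++ msupp q).
have ue : uniq e by exact: undup_uniq.
rewrite !(@fischerE e) // => [|m pm|m qm]; last 2 first.
- by rewrite mem_undup mem_cat pm.
- by rewrite mem_undup mem_cat qm orbT.
rewrite rmorph_sum; apply: eq_bigr => m _ /=.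
rewrite !rmorphM /= conjCK (CrealP (ger0_real (mfact_ge0 m))).
by rewrite [in LHS](mulrC (_ ^*)).
Qed.

Lemma fischer_linear p : scalar (fischer p).
Proof.
move=> c q1 q2; rewrite /fischer mulr_sumr -big_split; apply: eq_bigr => m _.
rewrite mcoeffD mcoeffZ /=; ring.
Qed.

HB.instance Definition _ p :=
  GRing.isLinear.Build C {mpoly C[n]} C *%R (fischer p) (@fischer_linear p).

Lemma fischerZl c p q : fischer (c *: p) q = c^* * fischer p q.
Proof. by rewrite fischerC linearZ rmorphM /= -fischerC. Qed.

Lemma fischer_suml I (r : seq I) (P : pred I) (F : I -> {mpoly C[n]}) q :
  fischer (\sum_(i <- r | P i) F i) q = \sum_(i <- r | P i) fischer (F i) q.
Proof.
rewrite fischerC linear_sum rmorph_sum; apply: eq_bigr => i _.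
by rewrite /= -fischerC.
Qed.

Lemma fischer_ge0 p : 0 <= fischer p p.
Proof.
by apply: sumr_ge0 => m _; rewrite mulr_ge0 ?mfact_ge0 // mulrC mul_conjC_ge0.
Qed.

Lemma fischer11 : fischer 1 1 = 1.
Proof.
rewrite /fischer msupp1 big_seq1 mcoeff1 eqxx conjC1 !mulr1 /mfact.
by rewrite big1 // => i _; rewrite mnm0E.
Qed.

(** The property that makes the Fischer form useful: it is the shift
    m |-> U_(i) + m of the monomials together with [mfactU]. *)
Lemma fischer_adjX i p q : fischer ('X_i * p) q = fischer p q^`M(i).
Proof.
rewrite /fischer mulrC (perm_big _ (msuppMX _ _)) big_map.
apply: eq_bigr => m _.
rewrite mfactU mcoeffMX mcoeff_deriv addmC -mulr_natr; ring.
Qed.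

Lemma mderivXn i p k : (p ^+ k)^`M(i) = p^`M(i) * p ^+ k.-1 *+ k.
Proof.
elim: k => [|k IH]; first by rewrite expr0 mulr0n -mpolyC1 mderivC.
rewrite exprS mderivM IH mulrS; congr (_ + _).
case: k {IH} => [|k]; first by rewrite !mulr0n mulr0.
by rewrite mulrnAr mulrCA -exprS.
Qed.

Lemma mderivXU i j : ('X_j : {mpoly C[n]})^`M(i) = (i == j)%:R.
Proof.
rewrite mderivX mnm1E eq_sym; case: eqP => [->|_]; last by rewrite scale0r.
rewrite scale1r (_ : (_ - _)%MM = 0%MM) ?mpolyX0 //.
by apply/mnmP => k; rewrite mnmBE subnn mnm0E.
Qed.

End Form.

(** The product rule, applied twice to rho^r L^a M^b, in the shape in which
    repeated use of [mderivM] leaves it: rho has derivatives w and z, L has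
    derivatives X and 0, M has derivatives 0 and Y, and p0, p1, p2, L1, L2, M1
    stand for the lowered powers. *)
Lemma product_second_derivative (K : comNzRingType)
    (z w X Y p0 p1 p2 L L1 L2 M M1 : K) (r r' a b a' : nat) :
  ((1%:R * p1 + w * (z * p2 *+ r')) *+ r * L + w * p1 *+ r * (0 * L1 *+ a) +
   (z * p1 *+ r * (X * L1 *+ a)
    + p0 * ((0 * L1 + X * (0 * L2 *+ a')) *+ a))) * M +
  (w * p1 *+ r * L + p0 * (X * L1 *+ a)) * (Y * M1 *+ b) =
  r%:R * (p1 * L * M) + (r * r')%:R * (z * w) * (p2 * L * M) +
  (r * b)%:R * (Y * w) * (p1 * L * M1) + (r * a)%:R * (X * z) * (p1 * L1 * M) +
  (a * b)%:R * (Y * X) * (p0 * L1 * M1).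
Proof. ring. Qed.

(** * Zonal harmonics and positivity of the Jacobi kernels *)

Section Zonal.
Variables (C : numClosedFieldType) (n : nat).
Local Open Scope sesquilinear_scope.
Implicit Types (x y : 'cV[C]_n) (p q g : {mpoly C[n + n]}).

Local Notation P := {mpoly C[n + n]}.
(** The 2n variables stand for the coordinates z and their conjugates, treated
    as independent; so no conjugation acts on the polynomials themselves. *)
Definition z_ (i : 'I_n) : P := 'X_(lshift n i).
Definition zb_ (i : 'I_n) : P := 'X_(rshift n i).
Definition rho : P := \sum_i z_ i * zb_ i.
Definition lin x : P := \sum_i x i 0 *: z_ i.
Definition alin x : P := \sum_i (x i 0)^* *: zb_ i.

Definition dlin x p : P := \sum_i (x i 0)^* *: p^`M(lshift n i).
Definition dalin x p : P := \sum_i x i 0 *: p^`M(rshift n i).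
Definition lap p : P := \sum_i p^`M(lshift n i)^`M(rshift n i).

Lemma lapZ c p : lap (c *: p) = c *: lap p.
Proof.
rewrite /lap scaler_sumr; apply: eq_bigr => i _.
by rewrite (mderivZ (lshift n i)) mderivZ.
Qed.

Lemma lap_sum I (r : seq I) (Q : pred I) (F : I -> P) :
  lap (\sum_(i <- r | Q i) F i) = \sum_(i <- r | Q i) lap (F i).
Proof.
rewrite /lap [RHS]exchange_big; apply: eq_bigr => i _ /=.
by rewrite (linear_sum (mderiv (lshift n i)))
  (linear_sum (mderiv (rshift n i))).
Qed.

Lemma fischer_adj_rho p q : fischer (rho * p) q = fischer p (lap q).
Proof.
rewrite /rho mulr_suml fischer_suml linear_sum; apply: eq_bigr => i _ /=.
by rewrite -mulrA !fischer_adjX mderiv_comm.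
Qed.

Lemma fischer_adj_rhon r p q :
  fischer (rho ^+ r * p) q = fischer p (iter r lap q).
Proof.
elim: r q => [|r IH] q; first by rewrite mul1r.
by rewrite iterSr -IH exprS -mulrA fischer_adj_rho.
Qed.

Lemma fischer_adj_lin x p q : fischer (lin x * p) q = fischer p (dlin x q).
Proof.
rewrite /lin mulr_suml fischer_suml linear_sum; apply: eq_bigr => i _ /=.
by rewrite -scalerAl fischerZl fischer_adjX linearZ.
Qed.

Lemma fischer_adj_alin x p q : fischer (alin x * p) q = fischer p (dalin x q).
Proof.
rewrite /alin mulr_suml fischer_suml linear_sum; apply: eq_bigr => i _ /=.
by rewrite -scalerAl fischerZl conjCK fischer_adjX linearZ.
Qed.

Lemma mderiv_lin_z x i : (lin x)^`M(lshift n i) = (x i 0)%:A.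
Proof.
rewrite linear_sum (bigD1 i) //= big1 ?addr0 => [|j ji].
  by rewrite mderivZ mderivXU eqxx.
rewrite mderivZ mderivXU (inj_eq (@lshift_inj _ _)) eq_sym (negbTE ji).
by rewrite scaler0.
Qed.

Lemma mderiv_lin_zb x i : (lin x)^`M(rshift n i) = 0.
Proof.
rewrite linear_sum big1 // => j _.
by rewrite /= mderivZ mderivXU eq_rlshift scaler0.
Qed.

Lemma mderiv_alin_zb x i : (alin x)^`M(rshift n i) = ((x i 0)^*)%:A.
Proof.
rewrite linear_sum (bigD1 i) //= big1 ?addr0 => [|j ji].
  by rewrite mderivZ mderivXU eqxx.
rewrite mderivZ mderivXU (inj_eq (@rshift_inj _ _)) eq_sym (negbTE ji).
by rewrite scaler0.
Qed.

Lemma mderiv_alin_z x i : (alin x)^`M(lshift n i) = 0.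
Proof.
rewrite linear_sum big1 // => j _.
by rewrite /= mderivZ mderivXU eq_lrshift scaler0.
Qed.

Lemma mderiv_rho_z i : rho^`M(lshift n i) = zb_ i.
Proof.
rewrite linear_sum (bigD1 i) //= big1 ?addr0 => [|j ji].
  by rewrite mderivM !mderivXU eqxx eq_lrshift mul1r mulr0 addr0.
rewrite mderivM !mderivXU (inj_eq (@lshift_inj _ _)) eq_sym (negbTE ji).
by rewrite eq_lrshift mul0r mulr0 addr0.
Qed.

Lemma mderiv_rho_zb i : rho^`M(rshift n i) = z_ i.
Proof.
rewrite linear_sum (bigD1 i) //= big1 ?addr0 => [|j ji].
  by rewrite mderivM !mderivXU eqxx eq_rlshift mulr1 mul0r add0r.
rewrite mderivM !mderivXU (inj_eq (@rshift_inj _ _)) (eq_sym i) (negbTE ji).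
by rewrite eq_rlshift mul0r mulr0 addr0.
Qed.

Lemma dlin_monomial y x a b : dlin y (lin x ^+ a * alin x ^+ b) =
  (dot y x * a%:R) *: (lin x ^+ a.-1 * alin x ^+ b).
Proof.
rewrite dotE mulr_suml scaler_suml; apply: eq_bigr => i _.
rewrite mderivM !mderivXn mderiv_lin_z mderiv_alin_z mul0r mul0rn mulr0 addr0.
rewrite -scaler_nat -!scalerAl mul1r !scalerA.
by congr (_ *: _); ring.
Qed.

Lemma dalin_alinX y x b : dalin y (alin x ^+ b) =
  ((dot y x)^* * b%:R) *: alin x ^+ b.-1.
Proof.
rewrite dotE rmorph_sum mulr_suml scaler_suml; apply: eq_bigr => i _ /=.
rewrite mderivXn mderiv_alin_zb -scalerAl mul1r -scaler_nat !scalerA.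
rewrite rmorphM /= conjCK.
by congr (_ *: _); ring.
Qed.

(** Move the linear forms one at a time to the right, where they become
    derivations. *)
Lemma fischer_monomial y x a b :
  fischer (lin y ^+ a * alin y ^+ b) (lin x ^+ a * alin x ^+ b) =
  (a`! * b`!)%:R * dot y x ^+ a * (dot y x)^* ^+ b.
Proof.
elim: a => [|a IH].
  rewrite !mul1r fact0 mul1n mulr1.
  elim: b => [|b IH]; first by rewrite fischer11 fact0 mulr1.
  rewrite exprS fischer_adj_alin dalin_alinX linearZ /= IH factS natrM exprS.
  ring.
rewrite exprS -mulrA fischer_adj_lin dlin_monomial linearZ /= IH.
rewrite !factS !natrM exprS; ring.
Qed.

(** The commutation of the Laplacian with |z|^2. In the factor
    n + (r - 1) + a + b, the dimension n comes from differentiating rho once in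
    both z_ i and zb_ i, for every i, and r - 1, a, b from differentiating two
    different factors of the product, where the Euler identity applies. *)
Lemma lap_monomial x r a b :
  lap (rho ^+ r * lin x ^+ a * alin x ^+ b) =
  (r * (n + r + a + b - 1))%:R *: (rho ^+ r.-1 * lin x ^+ a * alin x ^+ b)
  + ((a * b)%:R * dot x x) *: (rho ^+ r * lin x ^+ a.-1 * alin x ^+ b.-1).
Proof.
pose T : P := rho ^+ r.-1 * lin x ^+ a * alin x ^+ b.
pose T0 : P := rho ^+ r.-2 * lin x ^+ a * alin x ^+ b.
pose T1 : P := rho ^+ r.-1 * lin x ^+ a.-1 * alin x ^+ b.
pose T2 : P := rho ^+ r.-1 * lin x ^+ a * alin x ^+ b.-1.
pose T3 : P := rho ^+ r * lin x ^+ a.-1 * alin x ^+ b.-1.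
have -> : lap (rho ^+ r * lin x ^+ a * alin x ^+ b) =
    \sum_(i < n) r%:R * T + (r * r.-1)%:R * rho * T0 + (r * b)%:R * alin x * T2
    + (r * a)%:R * lin x * T1 + (a * b)%:R * (dot x x)%:A * T3.
  rewrite dotE scaler_suml !(mulr_sumr, mulr_suml) -!big_split.
  apply: eq_bigr => i _ /=.
  rewrite !(mderivM, mderivXn) mderiv_rho_z mderiv_lin_z mderiv_alin_z.
  rewrite mul0r mul0rn mulr0 addr0.
  rewrite !(mderivD, mderivMn, mderivM, mderivXn).
  have cA (c : C) j : (c%:A : P)^`M(j) = 0.
    by rewrite mderivZ -mpolyC1 mderivC scaler0.
  rewrite mderiv_rho_zb mderiv_lin_zb mderiv_alin_zb mderivXU eqxx cA.
  rewrite /T /T0 /T1 /T2 /T3.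
  rewrite -!(mulr_algl _ (z_ i)) -!(mulr_algl _ (zb_ i)).
  rewrite -[((_ * x i 0)%:A)]scalerA -(mulr_algl _ (_%:A)).
  exact: product_second_derivative.
(* Raise the lowered powers back; each factor that could cancel a lost power
   vanishes when the exponent is 0. *)
rewrite sumr_const card_ord -/T -/T3 -[_ *+ n]mulr_natl.
have -> : (r * r.-1)%:R * rho * T0 = (r * r.-1)%:R * T.
  rewrite /T0 /T; case: (r) => [|[|r0]]; rewrite ?muln0 ?mul0n ?mul0r //=.
  by rewrite (exprS _ r0); ring.
have -> : (r * b)%:R * alin x * T2 = (r * b)%:R * T.
  rewrite /T2 /T; case: (b) => [|b0]; rewrite ?muln0 ?mul0r //=.
  by rewrite (exprS _ b0); ring.
have -> : (r * a)%:R * lin x * T1 = (r * a)%:R * T.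
  rewrite /T1 /T; case: (a) => [|a0]; rewrite ?muln0 ?mul0r //=.
  by rewrite (exprS _ a0); ring.
have -> : (a * b)%:R * (dot x x)%:A * T3 = ((a * b)%:R * dot x x) *: T3.
  by rewrite -mulrA mulr_algl mulr_natl -scaler_nat scalerA.
congr (_ + _); rewrite scaler_nat mulrA -natrM.
rewrite !mulr_natl -!mulrnDr; congr (_ *+ _).
case: (r) => [|r0]; first by rewrite muln0 !mul0n.
by rewrite /= addnS !addSn subn1 /=; ring.
Qed.

Lemma iter_lap_monomial x r k l :
  iter r lap (lin x ^+ k * alin x ^+ l) =
  ((k ^_ r * l ^_ r)%:R * dot x x ^+ r) *:
    (lin x ^+ (k - r) * alin x ^+ (l - r)).
Proof.
elim: r => [|r IH]; first by rewrite !ffactn0 !subn0 mulr1 scale1r.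
rewrite iterS IH lapZ -[lin x ^+ _]mul1r -(expr0 rho) lap_monomial.
rewrite mul0n scale0r add0r !mul1r scalerA -!subnS !ffactnSr !natrM exprS.
by congr (_ *: _); ring.
Qed.

(** The harmonic part, up to a constant, of the reproducing polynomial
    (x^T z)^k (x^* zbar)^l. *)
Definition zonal k l x : P :=
  \sum_(r < (minn k l).+1) (jacobi_coef C n k l r * dot x x ^+ r) *:
    (rho ^+ r * lin x ^+ (k - r) * alin x ^+ (l - r)).

(** The recurrence that the Jacobi coefficients share with the commutation rule
    [lap_monomial]. *)
Lemma jacobi_coefS k l r : (2 <= n)%N -> (r < minn k l)%N ->
  jacobi_coef C n k l r.+1 * (r.+1 * (n + k + l - r - 2))%:R =
  - (jacobi_coef C n k l r * ((k - r) * (l - r))%:R).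
Proof.
move=> n2; rewrite leq_min => /andP[rk rl].
have [k' ->] : exists k', k = (k' + r.+1)%N by exists (k - r.+1)%N; lia.
have [l' ->] : exists l', l = (l' + r.+1)%N by exists (l - r.+1)%N; lia.
have [n' ->] : exists n', n = n'.+2 by exists (n - 2)%N; lia.
rewrite /jacobi_coef !addnK (_ : k' + r.+1 - r = k'.+1)%N; last by lia.
rewrite (_ : l' + r.+1 - r = l'.+1)%N; last by lia.
rewrite (_ : n'.+2 + (k' + r.+1) + (l' + r.+1) - r.+1 - 2
  = (n' + k' + l' + r).+1)%N; last by lia.
rewrite (_ : n'.+2 + (k' + r.+1) + (l' + r.+1) - r - 2
  = (n' + k' + l' + r).+2)%N; last by lia.
rewrite !factS !natrM exprS; field.
by rewrite !nat1r !pnatr_eq0 -!lt0n !fact_gt0.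
Qed.

(** The two families of terms produced by [lap_monomial] telescope: the first
    one at r + 1 cancels the second one at r, by [jacobi_coefS]. *)
Lemma lap_zonal k l x : (2 <= n)%N -> lap (zonal k l x) = 0.
Proof.
move=> n2; rewrite lap_sum.
under eq_bigr do rewrite lapZ lap_monomial scalerDr !scalerA.
rewrite big_split /= big_ord_recl mul0n mulr0 scale0r add0r.
rewrite [X in _ + X]big_ord_recr /=.
have -> : ((k - minn k l) * (l - minn k l) = 0)%N by lia.
rewrite mul0r mulr0 scale0r addr0 -big_split big1 // => -[r /= rkl] _.
rewrite /bump /= add1n -!subnS -scalerDl.
apply/eqP; rewrite scaler_eq0; apply/orP; left; apply/eqP.
have -> : (n + r.+1 + (k - r.+1) + (l - r.+1) - 1 = n + k + l - r - 2)%N.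
  by move: rkl; lia.
rewrite mulrAC jacobi_coefS // exprS; ring.
Qed.

(** The right argument is its leading term plus a multiple of rho, and the left
    argument is harmonic, hence orthogonal to multiples of rho. Only the leading
    term contributes, and each rho^r on the left turns into r Laplacians. *)
Lemma fischer_zonal k l x y : (2 <= n)%N ->
  fischer (zonal k l x) (zonal k l y) =
  jacobi_coef C n k l 0 * (k`! * l`!)%:R *
  \sum_(r < (minn k l).+1) jacobi_coef C n k l r * (dot x x * dot y y) ^+ r
     * dot x y ^+ (k - r) * (dot x y)^* ^+ (l - r).
Proof.
move=> n2; rewrite {2}/zonal big_ord_recl.
have -> : \sum_(i < minn k l) (jacobi_coef C n k l (lift ord0 i) *
      dot y y ^+ lift ord0 i) *:
      (rho ^+ lift ord0 i * lin y ^+ (k - lift ord0 i)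
        * alin y ^+ (l - lift ord0 i)) =
    rho * \sum_(i < minn k l) (jacobi_coef C n k l i.+1 * dot y y ^+ i.+1) *:
      (rho ^+ i * lin y ^+ (k - i.+1) * alin y ^+ (l - i.+1)).
  rewrite mulr_sumr; apply: eq_bigr => i _.
  by rewrite -scalerAr !mulrA -exprS.
rewrite linearD /= [X in _ + X]fischerC fischer_adj_rho lap_zonal //.
rewrite linear0 conjC0 addr0 !subn0 mulr1 mul1r linearZ /= -mulrA.
congr (_ * _).
rewrite fischer_suml mulr_sumr; apply: eq_bigr => -[r /= rkl] _.
have [rk rl] : (r <= k)%N /\ (r <= l)%N by move: rkl; lia.
rewrite fischerZl -mulrA fischer_adj_rhon iter_lap_monomial linearZ /=.
rewrite fischer_monomial.
have real_dot : (dot x x)^* = dot x x by rewrite -dotC.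
have -> : (jacobi_coef C n k l r * dot x x ^+ r)^* =
    jacobi_coef C n k l r * dot x x ^+ r.
  rewrite rmorphM /= rmorphXn /= real_dot; congr (_ * _).
  rewrite conj_Creal // /jacobi_coef rpred_div ?rpredM ?realn //.
  by rewrite rpredX // rpredN rpred1.
rewrite -(ffact_fact rk) -(ffact_fact rl) !natrM !exprMn.
ring.
Qed.

(** By [fischer_zonal] the kernel is a nonnegative multiple of the Gram
    matrix of the zonal polynomials. *)
Theorem jacobi_hom_psd k l (I : finType) (x : I -> 'cV[C]_n) (w : I -> C) :
  (2 <= n)%N ->
  0 <= \sum_b \sum_c (w b)^* * w c *
    jacobi_hom n k l (dot (x b) (x b) * dot (x c) (x c)) (dot (x b) (x c)).
Proof.
move=> n2.
pose coef0 := jacobi_coef C n k l 0 * (k`! * l`!)%:R.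
have coef0_gt0 : 0 < coef0.
  rewrite /coef0 /jacobi_coef mulr_gt0 ?ltr0n ?muln_gt0 ?fact_gt0 //.
  by rewrite mul1r divr_gt0 ?ltr0n ?muln_gt0 ?fact_gt0.
have scale_ge0 : 0 <= jacobi_scale C n k l.
  rewrite /jacobi_scale divr_ge0 ?mulr_ge0 ?ler0n // subr_ge0 ler_nat.
  by rewrite leq_mul // leq_bin2l // leq_sub2l.
pose F := \sum_b w b *: zonal k l (x b).
suff -> : \sum_b \sum_c (w b)^* * w c *
    jacobi_hom n k l (dot (x b) (x b) * dot (x c) (x c)) (dot (x b) (x c)) =
    jacobi_scale C n k l / coef0 * fischer F F.
  by rewrite mulr_ge0 ?fischer_ge0 // divr_ge0 // ltW.
rewrite fischer_suml mulr_sumr; apply: eq_bigr => b _.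
rewrite fischerZl linear_sum !mulr_sumr; apply: eq_bigr => c _.
rewrite linearZ /= fischer_zonal // /jacobi_hom -/coef0.
set S := bigop _ _ _; field; exact: lt0r_neq0.
Qed.

End Zonal.
End Fischer.

From mathcomp Require Import finmap complex.
From mathcomp Require Import boolp classical_sets functions cardinality fsbigop.
From mathcomp Require Import reals constructive_ereal ereal.

Local Open Scope classical_set_scope.
Local Open Scope complex_scope.
Local Open Scope sesquilinear_scope.
Local Open Scope ring_scope.

(** * Positive semidefinite matrices *)

Section Psd.
Variable C : numClosedFieldType.

Lemma quadE n (M : 'M[C]_n) (w : 'cV[C]_n) :
  (w ^t* *m M *m w) 0 0 = \sum_i \sum_j (w i 0)^* * w j 0 * M i j.
Proof.
rewrite exchange_big mxE; apply: eq_bigr => j _.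
rewrite mxE mulr_suml; apply: eq_bigr => i _; rewrite !mxE; ring.
Qed.

(** Polarization: a form with real values on all vectors is Hermitian; the
    vectors e_i + c e_j for c = 1 and c = 'i suffice. *)
Lemma psdmx_quad n (M : 'M[C]_n) :
  (forall w : 'cV[C]_n, 0 <= (w ^t* *m M *m w) 0 0) -> psdmx M.
Proof.
move=> Mge0; split=> //; apply/is_hermitianmxP; rewrite expr0 scale1r.
have bil (w1 w2 : 'cV[C]_n) c :
    ((w1 + c *: w2) ^t* *m M *m (w1 + c *: w2)) 0 0 =
    (w1 ^t* *m M *m w1) 0 0 + `|c| ^+ 2 * (w2 ^t* *m M *m w2) 0 0
    + (c * (w1 ^t* *m M *m w2) 0 0 + c^* * (w2 ^t* *m M *m w1) 0 0).
  have -> : (w1 + c *: w2) ^t* = w1 ^t* + c^* *: w2 ^t*.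
    by apply/matrixP => i j; rewrite !mxE rmorphD rmorphM.
  rewrite !(mulmxDl, mulmxDr).
  rewrite -!(scalemxAl, scalemxAr) !mxE normCK; ring.
have entry i j :
    ((delta_mx i 0 : 'cV[C]_n) ^t* *m M *m (delta_mx j 0 : 'cV_n)) 0 0 = M i j.
  by rewrite trmx_delta map_delta_mx -mulmxA -colE -rowE !mxE.
have Mreal (w : 'cV[C]_n) : (w ^t* *m M *m w) 0 0 \is Num.real.
  exact: ger0_real.
have diag_real i : M i i \is Num.real by rewrite -entry.
have cross i j c : c * M i j + c^* * M j i \is Num.real.
  have := Mreal (delta_mx i 0 + c *: delta_mx j 0).
  rewrite bil !entry rpredDl //.
  by rewrite rpredD // rpredM ?rpredX ?normr_real.
apply/matrixP => i j; rewrite !mxE.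
have /CrealP := cross i j 1; have /CrealP := cross i j 'i.
rewrite !rmorphD !rmorphM /= !conjCK !conjCi !conjC1 !mul1r => h1 h2.
have {}h1 : - (M i j)^* + (M j i)^* = M i j - M j i.
  apply: (mulfI (neq0Ci C)); move: h1; rewrite !mulNr => h1.
  by rewrite mulrDr mulrBr mulrN.
have : (M j i)^* *+ 2 = M i j *+ 2.
  transitivity (((M i j)^* + (M j i)^*) + (- (M i j)^* + (M j i)^*)).
    by rewrite mulr2n; ring.
  by rewrite h1 h2 mulr2n; ring.
by move/eqP; rewrite eqrMn2r => /= /eqP.
Qed.

Lemma psdmx_sum n (I : finType) (F : I -> 'M[C]_n) :
  (forall i, psdmx (F i)) -> psdmx (\sum_i F i).
Proof.
move=> Fpsd; apply: psdmx_quad => w; rewrite mulmx_sumr mulmx_suml summxE.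
by apply: sumr_ge0 => i _; case: (Fpsd i).
Qed.

Lemma psdmx_scale n (s : C) (M : 'M[C]_n) : 0 <= s -> psdmx M -> psdmx (s *: M).
Proof.
move=> s0 [_ Mge0]; apply: psdmx_quad => w.
by rewrite -scalemxAr -scalemxAl mxE mulr_ge0.
Qed.

Lemma psdmx_mx2_rank1 (s : C) : s \is Num.real -> psdmx (mx2 1 s s (s ^+ 2)).
Proof.
move=> sR; apply: psdmx_quad => w; rewrite quadE.
suff -> : \sum_i \sum_j (w i 0)^* * w j 0 * mx2 1 s s (s ^+ 2) i j =
    (w 0 0 + s * w (lift 0 0) 0)^* * (w 0 0 + s * w (lift 0 0) 0).
  by rewrite mulrC mul_conjC_ge0.
rewrite !big_ord_recl !big_ord0 !mxE /=.
rewrite rmorphD rmorphM /= (CrealP sR); ring.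
Qed.

Lemma psdmx_gram m n (x : 'I_n -> 'cV[C]_m) :
  psdmx (\matrix_(i, j) dot (x i) (x j)).
Proof.
apply: psdmx_quad => w; rewrite quadE; set y := \sum_i w i 0 *: x i.
suff -> : \sum_i \sum_j (w i 0)^* * w j 0 * (\matrix_(i, j) dot (x i) (x j)) i j
  = dot y y.
  by rewrite dotE sumr_ge0 // => i _; rewrite mulrC mul_conjC_ge0.
rewrite [RHS]dotE.
transitivity (\sum_i \sum_j \sum_k (w i 0 * x i k 0)^* * (w j 0 * x j k 0)).
  apply: eq_bigr => i _; apply: eq_bigr => j _; rewrite mxE dotE mulr_sumr.
  by apply: eq_bigr => k _; rewrite rmorphM /=; ring.
under eq_bigr do rewrite exchange_big.
rewrite exchange_big; apply: eq_bigr => k _ /=.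
rewrite !summxE rmorph_sum mulr_suml; apply: eq_bigr => i _.
by rewrite mulr_sumr; apply: eq_bigr => j _; rewrite !mxE.
Qed.

(** The orthogonal complement of a unit vector, identified with a coordinate
    space one dimension lower: U is the block below the first row of a unitary
    matrix whose first row is proportional to a^*. *)
Lemma exists_complement_coordinates d (a : 'cV[C]_d.+1) : dot a a = 1 ->
  exists U : 'M[C]_(d, d.+1), forall x y,
    dot (U *m x) (U *m y) = dot x y - dot x a * dot a y.
Proof.
move=> a1.
pose A : 'M[C]_(1 + d) := col_mx (a ^t*) 0.
pose V : 'M[C]_(1 + d) := schmidt A.
have Vu : V \is unitarymx by exact: schmidt_unitarymx.
pose u := usubmx V; pose U := dsubmx V.
have VV : u ^t* *m u + U ^t* *m U = 1%:M.
  rewrite -mul_row_col -map_row_mx -tr_col_mx vsubmxK.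
  by rewrite -(invmx_unitary Vu) mulVmx // unitarymx_unit.
have uu : u *m u ^t* = 1%:M.
  have /unitarymxP : V \is unitarymx by [].
  rewrite -[V]vsubmxK tr_col_mx map_row_mx mul_col_row (scalar_mx_block _ _ 1).
  by case/eq_block_mx.
(* Gram-Schmidt keeps the first row up to a scalar, of modulus 1 here. *)
have [c ac] : exists c, a ^t* = c *: u.
  apply/sub_rVP.
  have := row_schmidt_sub A (lshift d 0); rewrite -/V.
  rewrite (big_pred1 (lshift d 0)) => [|i]; last first.
    by rewrite /= leqn0 -val_eqE.
  rewrite genmxE rowKu row_id; congr (_ <= _)%MS.
  by apply/matrixP => i j; rewrite ord1 !mxE; congr (V _ _); apply: val_inj.
have aE : a = c^* *: u ^t*.
  rewrite -(trmxCK a) ac.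
  by apply/matrixP => i j; rewrite !mxE rmorphM.
have cc : c^* * c = 1.
  move: a1; rewrite /dot ac aE -scalemxAl -scalemxAr scalerA uu !mxE eqxx mulr1.
  by rewrite mulrC.
exists U => x y.
have aa : a *m a ^t* = u ^t* *m u.
  by rewrite ac {1}aE -scalemxAl -scalemxAr scalerA cc scale1r.
rewrite /dot trmx_mul map_mxM /= mulmxA -(mulmxA _ _ U).
have -> : U ^t* *m U = 1%:M - a *m a ^t* by rewrite aa -VV addrC addKr.
rewrite mulmxBr mulmxBl mulmx1 [LHS]mxE [X in _ + X]mxE; congr (_ - _).
by rewrite mulmxA -(mulmxA (_ *m a)) [LHS]mxE big_ord1.
Qed.

(** This removes the case distinction, so that points of the code proportional to
    the fixed first point need no separate treatment. *)
Lemma Yentry_disc d i j (u v t : C) p q : `|u| <= 1 -> `|v| <= 1 ->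
  Yentry d i j u v t p q =
  (u * u^*) ^+ p * (v * v^*) ^+ q *
  jacobi_hom (d - 1) i j ((1 - u * u^*) * (1 - v * v^*)) (t - u^* * v).
Proof.
move=> u1 v1; have [uv1|] := boolP ((`|u| == 1) || (`|v| == 1)).
  by rewrite /Yentry uv1.
rewrite negb_or => /andP[u1' v1'].
by rewrite YentryE // lt_neqAle ?u1' ?v1'.
Qed.

(** With u = a^* b and v = a^* c, the vectors U b and U c have squared norms
    1 - |u|^2, 1 - |v|^2 and inner product t - u^* v, the arguments of the
    Jacobi kernel in dimension d - 1. The factors |u|^2p and |v|^2q only change
    the weights attached to b and c. *)
Lemma Ymx_sum_psd d k l i j (I : finType) (x : I -> 'cV[C]_d) (a : 'cV[C]_d) :
  (3 <= d)%N -> dot a a = 1 -> (forall b, dot (x b) (x b) = 1) ->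
  (forall b, `|dot a (x b)| <= 1) ->
  psdmx (\sum_b \sum_c
    Ymx d k l i j (dot a (x b)) (dot a (x c)) (dot (x b) (x c))).
Proof.
case: d x a => // d x a d2 a1 x1 ax; apply: psdmx_quad => w.
have [U UE] := exists_complement_coordinates a1.
pose s b := dot a (x b) * (dot a (x b))^*.
pose W b := \sum_p w p 0 * s b ^+ p.
suff -> : (w ^t* *m (\sum_b \sum_c Ymx d.+1 k l i j (dot a (x b)) (dot a (x c))
      (dot (x b) (x c))) *m w) 0 0 =
    \sum_b \sum_c (W b)^* * W c * jacobi_hom d i j
      (dot (U *m x b) (U *m x b) * dot (U *m x c) (U *m x c))
      (dot (U *m x b) (U *m x c)).
  exact: Fischer.jacobi_hom_psd.
rewrite mulmx_sumr mulmx_suml summxE; apply: eq_bigr => b _.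
rewrite mulmx_sumr mulmx_suml summxE; apply: eq_bigr => c _.
rewrite quadE rmorph_sum !mulr_suml; apply: eq_bigr => p _.
rewrite mulr_sumr mulr_suml; apply: eq_bigr => q _.
rewrite mxE Yentry_disc // !UE !x1 !(dotC a) subn1 /=.
rewrite rmorphM rmorphXn /=.
have -> : (s b)^* = s b by rewrite rmorphM /= conjCK mulrC.
rewrite -![(dot a (x _))^* * dot a (x _)]mulrC.
rewrite -/(s b) -/(s c); set J := jacobi_hom _ _ _ _ _; ring.
Qed.

End Psd.

(** * Counting triples of points by their inner products *)

Section Counting.

Lemma fsbig_fiber (V : nmodType) (Q : finType) (K : choiceType) (f : Q -> K)
    (S : set K) (g : K -> V) :
  \sum_(p \in S) g p *+ #|[pred q | f q == p]| =
  \sum_(q | `[< S (f q) >]) g (f q).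
Proof.
pose r := [seq p <- undup (codom f) | `[< S p >]].
have ur : uniq r by rewrite filter_uniq ?undup_uniq.
rewrite (@fsbigE _ _ _ _ _ r) //; last 2 first.
- by move=> p /=; rewrite mem_filter => /andP[/asboolP].
- move=> p Sp; rewrite mem_filter mem_undup asboolT //= => pf.
  rewrite eq_card0 ?mulr0n // => q; rewrite !inE; apply/eqP => fq.
  by move: pf; rewrite -fq codom_f.
rewrite -big_filter (all_filterP _); last first.
  by apply/allP => p; rewrite mem_filter inE => /andP[/asboolP].
transitivity (\sum_(p <- r) \sum_(q | f q == p) g (f q)).
  apply: eq_bigr => p _; rewrite -sumr_const; apply: eq_big => // q.
  by rewrite inE => /eqP ->.
rewrite (exchange_big_dep xpredT) //= [RHS]big_mkcond; apply: eq_bigr => q _.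
rewrite -big_filter; case: asboolP => Sq.
  rewrite (@perm_big _ _ _ _ _ [:: f q]) ?big_seq1 //.
  apply: uniq_perm; rewrite ?filter_uniq ?undup_uniq // => p.
  rewrite mem_filter !inE eq_sym; case: eqP => //= ->.
  by rewrite mem_filter mem_undup codom_f asboolT.
rewrite big_seq big1 // => p; rewrite mem_filter => /andP[/eqP fq].
by rewrite mem_filter -fq => /andP[/asboolP].
Qed.

Variables (C : numClosedFieldType) (d : nat) (T : finType) (c : T -> 'cV[C]_d).
Variable A : set C.
Hypothesis c_unit : forall a, dot (c a) (c a) = 1.
Hypothesis c_angle : forall a b, a != b -> A (dot (c a) (c b)).
Hypothesis A1 : ~ A 1.
Hypothesis A_le1 : forall u, A u -> `|u| <= 1.
Local Notation N := #|T|.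

Definition triangle (q : T * T * T) : C * C * C :=
  (dot (c q.1.1) (c q.1.2), dot (c q.1.1) (c q.2), dot (c q.1.2) (c q.2)).

Definition triangle_count (p : C * C * C) : nat :=
  #|[pred q | triangle q == p]|.

Lemma dot_le1 a b : `|dot (c a) (c b)| <= 1.
Proof.
by have [->|/c_angle/A_le1 //] := eqVneq a b; rewrite c_unit normr1.
Qed.

Lemma dot_eq1 a b : (dot (c a) (c b) == 1) = (a == b).
Proof.
have [->|/c_angle ab] := eqVneq a b; first by rewrite c_unit eqxx.
by apply/eqP => ab1; move: ab; rewrite ab1.
Qed.

Lemma dot_angle a b : A (dot (c a) (c b)) <-> a != b.
Proof.
split=> [|/c_angle //].
by have [->|//] := eqVneq a b; rewrite c_unit => /A1.
Qed.

(** The invariance conditions on the dual variables all come from permuting the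
    three points: s permutes the points and phi is the induced map on inner
    products. *)
Lemma triangle_count_perm (s : T * T * T -> T * T * T)
    (phi : C * C * C -> C * C * C) p :
  injective s -> injective phi ->
  (forall q, triangle (s q) = phi (triangle q)) ->
  triangle_count p = triangle_count (phi p).
Proof.
move=> s_inj phi_inj sphi; rewrite /triangle_count -!sum1_card.
rewrite [RHS](reindex_inj s_inj); apply: eq_bigl => q.
by rewrite !inE sphi (inj_eq phi_inj).
Qed.

(** An inner product equal to 1 forces the last two points to coincide. *)
Lemma triangle_count_diag u : triangle_count (u, u, 1) =
  #|[pred e : T * T | dot (c e.1) (c e.2) == u]|.
Proof.
rewrite /triangle_count -!sum1_card.
rewrite (reindex_onto (fun e : T * T => (e.1, e.2, e.2)) (fun q => q.1)).
  apply: eq_bigl => -[a b]; rewrite !inE /triangle /= !xpair_eqE c_unit !eqxx.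
  by rewrite !andbT andbb.
move=> [[a b] e] /=; rewrite inE /triangle /= !xpair_eqE dot_eq1.
by case/andP=> _ /eqP ->.
Qed.

Lemma triangle_psd a b e :
  psdmx (gram3 (dot (c a) (c b)) (dot (c a) (c e)) (dot (c b) (c e))).
Proof.
pose x (i : 'I_3) := c (tnth [tuple a; b; e] i).
suff -> : gram3 (dot (c a) (c b)) (dot (c a) (c e)) (dot (c b) (c e)) =
    \matrix_(i, j) dot (x i) (x j) by exact: psdmx_gram.
apply/matrixP => i j; rewrite !mxE.
case: i => [[|[|[|//]]] ?]; case: j => [[|[|[|//]]] ?] /=;
  by rewrite /x !(tnth_nth a) /= ?c_unit // -dotC.
Qed.

Lemma triangle_in_D q : tripleD A (triangle q) <->
  [/\ q.1.1 != q.1.2, q.1.1 != q.2 & q.1.2 != q.2].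
Proof.
by split=> [[/dot_angle ? /dot_angle ? /dot_angle ?]|[? ? ?]]; split=> //=;
  try exact: c_angle; exact: triangle_psd.
Qed.

(** The three parts of [tripleD0 A] are the three ways for exactly two of the
    points to coincide. Three equal points give (1, 1, 1), which lies outside
    since 1 is not in A. *)
Lemma triangle_in_DD0 q : (tripleD A `|` tripleD0 A) (triangle q) <->
  ~~ [&& q.1.1 == q.1.2 & q.1.2 == q.2].
Proof.
case: q => -[a b] e /=; split.
  move=> SD; apply/negP => /andP[/eqP ab /eqP be]; move: SD.
  rewrite /triangle /= -be -ab c_unit.
  case=> [[] //|[[[u Au [u1 _]]|[u Au [u1 _]]]|[u Au [_ u1]]]].
  - by move: Au; rewrite u1.
  - by move: Au; rewrite u1.
  - by move: Au; rewrite u1.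
have [<-|ab] := eqVneq a b => /= ae.
  right; right; exists (dot (c a) (c e)); first exact: c_angle.
  by rewrite /triangle /= c_unit.
have [<-|ne] := eqVneq b e.
  right; left; left; exists (dot (c a) (c b)); first exact: c_angle.
  by rewrite /triangle /= c_unit.
have [<-|nae] := eqVneq a e.
  right; left; right; exists (dot (c a) (c b)); first exact: c_angle.
  by rewrite /triangle /= c_unit -dotC.
by left; apply/triangle_in_D.
Qed.

Lemma sum_over_angles (V : nmodType) (g : C -> V) :
  \sum_(u \in A) g u *+ triangle_count (u, u, 1) =
  \sum_(e : T * T | e.1 != e.2) g (dot (c e.1) (c e.2)).
Proof.
under eq_fsbigr do rewrite triangle_count_diag.
rewrite (fsbig_fiber (fun e : T * T => dot (c e.1) (c e.2))).
by apply: eq_bigl => e; apply/asboolP/idP => /dot_angle.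
Qed.

Lemma sum_over_D (V : nmodType) (g : C * C * C -> V) :
  \sum_(p \in tripleD A) g p *+ triangle_count p =
  \sum_(q | [&& q.1.1 != q.1.2, q.1.1 != q.2 & q.1.2 != q.2]) g (triangle q).
Proof.
rewrite fsbig_fiber; apply: eq_bigl => q.
apply/asboolP/idP => [/triangle_in_D/and3P //|/and3P q3]; exact/triangle_in_D.
Qed.

Lemma sum_over_DD0 (V : nmodType) (g : C * C * C -> V) :
  \sum_(p \in tripleD A `|` tripleD0 A) g p *+ triangle_count p =
  \sum_(q | ~~ [&& q.1.1 == q.1.2 & q.1.2 == q.2]) g (triangle q).
Proof.
rewrite fsbig_fiber; apply: eq_bigl => q.
by apply/asboolP/idP => /triangle_in_DD0.
Qed.

(** This and the next lemma explain the constant terms of the constraints: the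
    coinciding points contribute N times the value at inner product 1. *)
Lemma sum_pairs (V : nmodType) (g : C -> V) :
  \sum_(e : T * T) g (dot (c e.1) (c e.2)) =
  g 1 *+ N + \sum_(e : T * T | e.1 != e.2) g (dot (c e.1) (c e.2)).
Proof.
rewrite (bigID (fun e : T * T => e.1 == e.2)) /=; congr (_ + _).
rewrite (reindex_onto (fun a => (a, a)) fst) => [|[a b] /= /eqP -> //].
rewrite -sumr_const; apply: eq_big => [a|a _] /=; first by rewrite !eqxx.
by rewrite c_unit.
Qed.

Lemma sum_triples (V : nmodType) (g : C * C * C -> V) :
  \sum_q g (triangle q) =
  g (1, 1, 1) *+ N
  + \sum_(q | ~~ [&& q.1.1 == q.1.2 & q.1.2 == q.2]) g (triangle q).
Proof.
rewrite (bigID (fun q : T * T * T => [&& q.1.1 == q.1.2 & q.1.2 == q.2])) /=.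
congr (_ + _).
rewrite (reindex_onto (fun a => (a, a, a)) (fun q => q.1.1)); last first.
  by case=> -[a b] e /= /andP[/eqP -> /eqP ->].
rewrite -sumr_const; apply: eq_big => [a|a _] /=; first by rewrite !eqxx.
by rewrite /triangle /= c_unit.
Qed.

Lemma card_neq_pairs : #|[pred e : T * T | e.1 != e.2]| = (N * (N - 1))%N.
Proof.
rewrite -sum1_card.
rewrite -(pair_big_dep xpredT (fun a b => a != b) (fun _ _ => 1%N)) /=.
rewrite -sum_nat_const; apply: eq_bigr => a _.
rewrite sum1_card subn1 -(cardC1 a); apply: eq_card => b.
by rewrite !inE eq_sym.
Qed.

Lemma card_neq_triples :
  #|[pred q : T * T * T | [&& q.1.1 != q.1.2, q.1.1 != q.2 & q.1.2 != q.2]]|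
  = (N * (N - 1) * (N - 2))%N.
Proof.
rewrite -card_neq_pairs -sum1_card -sum_nat_const.
rewrite (eq_bigl (fun q =>
  (q.1.1 != q.1.2) && ((q.1.1 != q.2) && (q.1.2 != q.2)))) //.
rewrite -(pair_big_dep (fun e : T * T => e.1 != e.2)
  (fun e b => (e.1 != b) && (e.2 != b)) (fun _ _ => 1%N)) /=.
apply: eq_bigr => -[a b] /= ab; rewrite sum1_card.
rewrite -(cardC (pred2 a b)) card2 ab addKn; apply: eq_card => e.
by rewrite !inE negb_or eq_sym [e == b]eq_sym.
Qed.

End Counting.

(** * The feasible point given by a code *)

Section Feasible.
Variables (R : realType) (d : nat) (A : set R[i]) (T : finType).
Variable c : T -> 'cV[R[i]]_d.
Hypothesis d_ge3 : (3 <= d)%N.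
Hypothesis T_gt0 : (0 < #|T|)%N.
Hypothesis c_unit : forall a, dot (c a) (c a) = 1.
Hypothesis c_angle : forall a b, a != b -> A (dot (c a) (c b)).
Hypothesis A1 : ~ A 1.
Hypothesis A_le1 : forall u, A u -> `|u| <= 1.
Local Notation N := #|T|.

(** The feasible point attached to the code. Division by N turns the
    contribution of the triples (a, a, a) into the constant terms of the
    constraints. *)
Definition triangle_density (p : R[i] * R[i] * R[i]) : R :=
  (triangle_count c p)%:R / N%:R.

Lemma N_neq0 (K : numDomainType) : N%:R != 0 :> K.
Proof. by rewrite pnatr_eq0 -lt0n. Qed.

Lemma densityZ (V : lmodType R[i]) p (v : V) :
  (triangle_density p)%:C *: v = (N%:R^-1 *: v) *+ triangle_count c p.
Proof.
by rewrite /triangle_density rmorphM fmorphV !rmorph_nat -scalerA scaler_nat.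
Qed.

(** The N (N - 1) ordered pairs of distinct points, divided by N. *)
Lemma density_objective :
  \sum_(u \in A) triangle_density (u, u, 1) = (N - 1)%:R.
Proof.
rewrite (eq_fsbigr (fun u => N%:R^-1 *+ triangle_count c (u, u, 1)));
  last first.
  by move=> u _; rewrite /triangle_density mulrC mulr_natr.
rewrite (sum_over_angles c_unit c_angle A1 (fun=> N%:R^-1)) sumr_const.
by rewrite card_neq_pairs -[LHS]mulr_natr natrM mulrA mulVf ?mul1r ?N_neq0.
Qed.

Lemma density_sym u v t : A u -> A v -> A t ->
  [/\ triangle_density (u, v, t) = triangle_density (v, u, t^*),
      triangle_density (u, v, t) = triangle_density (t^*, v^*, u^*),
      triangle_density (u, v, t) = triangle_density (v^*, t^*, u),
      triangle_density (u, v, t) = triangle_density (u^*, t, v) &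
      triangle_density (u, v, t) = triangle_density (t, u^*, v^*)].
Proof.
move=> _ _ _; have cI := inv_inj (@conjCK R[i]).
pose perm (s : T * T * T -> T * T * T) phi := triangle_count_perm
  (c := c) (s := s) (phi := phi) (u, v, t).
split; congr (_%:R / _).
- apply: (perm (fun q => (q.1.1, q.2, q.1.2))
    (fun p => (p.1.2, p.1.1, p.2^*))).
  + by move=> [[? ?] ?] [[? ?] ?] [-> -> ->].
  + by move=> [[? ?] ?] [[? ?] ?] [-> -> /cI ->].
  + by move=> [[a b] e]; rewrite /triangle /= -dotC.
- apply: (perm (fun q => (q.2, q.1.2, q.1.1))
    (fun p => (p.2^*, p.1.2^*, p.1.1^*))).
  + by move=> [[? ?] ?] [[? ?] ?] [-> -> ->].
  + by move=> [[? ?] ?] [[? ?] ?] [/cI -> /cI -> /cI ->].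
  + by move=> [[a b] e]; rewrite /triangle /= -!dotC.
- apply: (perm (fun q => (q.2, q.1.1, q.1.2))
    (fun p => (p.1.2^*, p.2^*, p.1.1))).
  + by move=> [[? ?] ?] [[? ?] ?] [-> -> ->].
  + by move=> [[? ?] ?] [[? ?] ?] [/cI -> /cI -> ->].
  + by move=> [[a b] e]; rewrite /triangle /= -!dotC.
- apply: (perm (fun q => (q.1.2, q.1.1, q.2))
    (fun p => (p.1.1^*, p.2, p.1.2))).
  + by move=> [[? ?] ?] [[? ?] ?] [-> -> ->].
  + by move=> [[? ?] ?] [[? ?] ?] [/cI -> -> ->].
  + by move=> [[a b] e]; rewrite /triangle /= -!dotC.
- apply: (perm (fun q => (q.1.2, q.2, q.1.1))
    (fun p => (p.2, p.1.1^*, p.1.2^*))).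
  + by move=> [[? ?] ?] [[? ?] ?] [-> -> ->].
  + by move=> [[? ?] ?] [[? ?] ?] [-> /cI -> /cI ->].
  + by move=> [[a b] e]; rewrite /triangle /= -!dotC.
Qed.

Lemma density_ge0 p : 0 <= triangle_density p.
Proof. by rewrite divr_ge0 ?ler0n. Qed.

Lemma density_finite (S : set (R[i] * R[i] * R[i])) :
  finite_set [set p | S p /\ triangle_density p <> 0].
Proof.
apply: (@sub_finite_set _ _ [set` codom (triangle c)]) => // p [_ /= p_neq0].
apply: contra_notT p_neq0 => pNc.
rewrite /triangle_density /triangle_count eq_card0 ?mul0r // => q.
by rewrite !inE; apply: contraNF pNc => /eqP <-; exact: codom_f.
Qed.

(** The matrix has entries 1, S, S, S + T with S = N - 1 and
    T = (N - 1) (N - 2), so S + T = S^2 and it has rank one. *)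
Lemma density_mx2 :
  psdmx (mx2 1 0 0 0
         + \sum_(u \in A) (triangle_density (u, u, 1))%:C *: mx2 0 1 1 1
         + \sum_(p \in tripleD A) (triangle_density p)%:C *: mx2 0 0 0 1).
Proof.
under eq_fsbigr do rewrite densityZ.
under [X in _ + X]eq_fsbigr do rewrite densityZ.
rewrite (sum_over_angles c_unit c_angle A1 (fun=> N%:R^-1 *: mx2 0 1 1 1)).
rewrite (sum_over_D c_unit c_angle A1 (fun=> N%:R^-1 *: mx2 0 0 0 1)).
rewrite !sumr_const card_neq_pairs card_neq_triples.
suff -> : mx2 1 0 0 0 + N%:R^-1 *: mx2 0 1 1 1 *+ (N * (N - 1))
    + N%:R^-1 *: mx2 0 0 0 1 *+ (N * (N - 1) * (N - 2)) =
    mx2 1 (N - 1)%:R (N - 1)%:R ((N - 1)%:R ^+ 2) :> 'M[R[i]]_2.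
  by apply: psdmx_mx2_rank1; exact: realn.
have NN k : N%:R^-1 *+ (N * k) = k%:R :> R[i].
  by rewrite -[LHS]mulr_natr natrM mulrA mulVf ?mul1r ?N_neq0.
apply/matrixP => i j; rewrite !mxE !mulmxnE !mxE -mulnA -!mulrnAl !NN.
case: i => [[|[|//]] ?]; case: j => [[|[|//]] ?] /=;
  rewrite ?(mulr0, mulr1, addr0, add0r) //.
rewrite -natrX -natrD; congr (_%:R).
by case: (#|T|) => [|[|m]]; rewrite ?subn1 //= !subSS subn0; ring.
Qed.

Lemma sum_jacobi_ge0 k l :
  0 <= \sum_(e : T * T) jacobi d k l (dot (c e.1) (c e.2)).
Proof.
rewrite -(pair_bigA _ (fun a b => jacobi d k l (dot (c a) (c b)))) /=.
have := Fischer.jacobi_hom_psd k l c (fun=> 1) (ltnW d_ge3).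
congr (0 <= _); apply: eq_bigr => a _; apply: eq_bigr => b _.
rewrite conjC1 !mul1r !c_unit mulr1 /jacobi_hom /jacobi; congr (_ * _).
by apply: eq_bigr => r _; rewrite expr1n mulr1.
Qed.

(** Multiplied by N, the constraint is the double sum of [sum_jacobi_ge0]. *)
Lemma density_jacobi k l :
  0 <= jacobi d k l 1
       + \sum_(u \in A) (triangle_density (u, u, 1))%:C * jacobi d k l u.
Proof.
rewrite (eq_fsbigr (fun u =>
  (N%:R^-1 * jacobi d k l u) *+ triangle_count c (u, u, 1))).
  rewrite (sum_over_angles c_unit c_angle A1) -mulr_sumr.
  rewrite -(pmulr_rge0 _ (_ : 0 < N%:R)) ?ltr0n // mulrDr mulVKf ?N_neq0 //.
  by rewrite mulr_natl -(sum_pairs c_unit (jacobi d k l)) sum_jacobi_ge0.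
by move=> u _; exact: (@densityZ R[i]^o).
Qed.

(** Multiplied by N, the matrix is the sum over all triples (a, b, e) of points;
    the part with fixed a is positive semidefinite by [Ymx_sum_psd]. *)
Lemma density_Ymx k l i j :
  psdmx (Ymx d k l i j 1 1 1
         + \sum_(p \in tripleD A `|` tripleD0 A)
             (triangle_density p)%:C *: Ymx d k l i j p.1.1 p.1.2 p.2).
Proof.
under eq_fsbigr do rewrite densityZ.
pose Y (p : R[i] * R[i] * R[i]) := Ymx d k l i j p.1.1 p.1.2 p.2.
rewrite (sum_over_DD0 c_unit c_angle A1 (fun p => N%:R^-1 *: Y p)) -scaler_sumr.
have -> : Ymx d k l i j 1 1 1 = N%:R^-1 *: (Y (1, 1, 1) *+ N).
  by rewrite -[Y _ *+ _]scaler_nat scalerA mulVf ?scale1r ?N_neq0.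
rewrite -scalerDr -(sum_triples c_unit Y).
apply: psdmx_scale; first by rewrite invr_ge0 ler0n.
rewrite -(pair_bigA _ (fun e b => Y (triangle c (e, b)))) /=.
rewrite -(pair_bigA _ (fun a b => \sum_e Y (triangle c (a, b, e)))) /=.
apply: psdmx_sum => a.
apply: (@Ymx_sum_psd _ d k l i j T c (c a)) => // b.
exact: (dot_le1 c_unit c_angle A_le1).
Qed.

Lemma density_feasible : feasible d A triangle_density.
Proof.
split; [exact: density_sym | by move=> *; exact: density_ge0 |
  exact: density_finite | split].
- exact: density_mx2.
- exact: density_jacobi.
- by move=> k l i j _ _; exact: density_Ymx.
Qed.

End Feasible.

Theorem theorem3p3 (R : realType) (d : nat) (A : set R[i])
  (d_ge3 : (3 <= d)%N)
  (A_sub : A `<=` [set z | `|z| <= 1] `\ 1)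
  (A_conj : [set c^* | c in A] = A)
  (X : {fset 'cV[R[i]]_d})
  (X_neq0 : X != fset0)
  (X_sphere : [set` X] `<=` sphere d)
  (X_angles : angles [set` X] `<=` A) :
  ((#|` X|%:R)%:E <=
     1 + ereal_sup [set (\sum_(u \in A) x (u, u, 1))%:E | x in feasible d A])%E.
Proof.
have X_gt0 : (0 < #|{: X}|)%N by rewrite -cardfE cardfs_gt0.
have c_unit (a : X) : dot (val a) (val a) = 1 by exact: X_sphere (valP a).
have c_angle (a b : X) : a != b -> A (dot (val a) (val b)).
  move=> ab; apply: X_angles; exists (val a), (val b); split=> //.
  - exact: valP.
  - exact: valP.
  - by apply/eqP; rewrite (inj_eq val_inj).
have A1 : ~ A 1 by case/A_sub => _; apply.
have A_le1 u : A u -> `|u| <= 1 by case/A_sub.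
have feas := density_feasible d_ge3 X_gt0 c_unit c_angle A1 A_le1.
have obj := density_objective X_gt0 c_unit c_angle A1.
rewrite cardfE -(subnKC X_gt0) natrD EFinD leeD2l //.
apply: ereal_sup_ubound; eexists; first exact: feas.
by rewrite obj.
Qed.
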